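(* Let $q$ be a prime power and $m>1$ an integer. Then the number of irreducible TSRs of order two over $\mathbb F_{q^m}$ is $$\left|\operatorname{TSRI}(m,2,q)\right|=\begin{cases}\dfrac{q}{2m}\displaystyle\prod_{i=0}^{m-1}(q^m-q^i) & \text{if } q \text{ is odd and } m=2^\ell,\\[2mm] \dfrac{q}{2m}\displaystyle\prod_{i=1}^{m-1}(q^m-q^i)\sum_{d\mid m,\ d\text{ odd}}\mu(d)q^{m/d} & \text{if } q \text{ is odd and } m=2^\ell k \text{ with } k\ge 3\text{ odd},\\[2mm] \dfrac{q-1}{2m}\displaystyle\prod_{i=1}^{m-1}(q^m-q^i)\sum_{d\mid m,\ d\text{ odd}}\mu(d)q^{m/d} & \text{otherwise},\end{cases}$$ where $\mu$ is the Möbius function.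
   Context: $\operatorname{TSR}(m,n,q)$ denotes the set of $mn\times mn$ matrices $T$ over $\mathbb F_q$ which, viewed as $n\times n$ block matrices with $m\times m$ blocks, have the form: the block in position $(i+1,i)$ is $I_m$ for $i=1,\dots,n-1$; the last block column is $(c_0A, c_1A,\dots,c_{n-1}A)^{\top}$ for some $c_0,\dots,c_{n-1}\in\mathbb F_q$ and $A\in M_m(\mathbb F_q)$; all other blocks are zero. $\operatorname{TSRI}(m,n,q)$ is the set of $T\in\operatorname{TSR}(m,n,q)$ whose characteristic polynomial $\det(XI_{mn}-T)$ is irreducible over $\mathbb F_q$; these are the irreducible TSRs of order $n$ over $\mathbb F_{q^m}$. *)

(* Defs.v *)
From HB Require Import structures.
From mathcomp Require Import all_boot all_order all_algebra.

Set Implicit Arguments.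
Unset Strict Implicit.
Unset Printing Implicit Defensive.

Import GRing.Theory Num.Theory.
Local Open Scope ring_scope.

Definition mobius (d : nat) : int :=
  if (0 < d)%N && all (fun p => logn p d == 1%N) (primes d)
  then (-1) ^+ size (primes d) else 0.

Lemma sum_blocks (m n : nat) : (\sum_(i < n) m = m * n)%N.
Proof. by rewrite sum_nat_const card_ord mulnC. Qed.

Section TSR.

Variables (F : finFieldType) (m n : nat).

(* Blocks are indexed from 0, so the last block column is the one with
   j.+1 = n, and its test takes precedence over the subdiagonal one, which
   cannot hold there. \mxblock produces a matrix of size \sum_(i < n) m;
   the cast only restates this size as m * n. *)
Definition tsr_mx (c : {ffun 'I_n -> F}) (A : 'M[F]_m) : 'M[F]_(m * n) :=
  castmx (sum_blocks m n, sum_blocks m n)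
    (\mxblock_(i < n, j < n)
       (if j.+1 == n then c i *: A
        else if i == j.+1 :> nat then 1%:M else 0 : 'M[F]_m)).

Definition TSR : {set 'M[F]_(m * n)} :=
  [set tsr_mx c A | c : {ffun 'I_n -> F}, A : 'M[F]_m].

(* irreducibleb is the boolean form of irreducible_poly over a finite field
   (irreducibleP). *)
Definition TSRI : {set 'M[F]_(m * n)} :=
  [set T in TSR | irreducibleb (char_poly T)].

End TSR.

Arguments TSR : clear implicits.
Arguments TSRI : clear implicits.

(* Main.v *)
Require Import Defs.
From HB Require Import structures.
From mathcomp Require Import all_boot all_order all_algebra all_fingroup all_field.
From mathcomp Require Import zify ring.

Set Implicit Arguments.
Unset Strict Implicit.
Unset Printing Implicit Defensive.

Import GRing.Theory Num.Theory.
Local Open Scope ring_scope.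

(** Scaling [(c, A)] one may take [c_0 = 1]; then [T] has characteristic
    polynomial [\det (X^2 - (b X + 1) A)] with [b = c_1]. Its irreducibility
    forces that of [char_poly A], and for a root [a] of [char_poly A] in the
    field [K] with [q^m] elements it amounts to [z^2 - a (b z + 1)] having no
    root in [K]. Each irreducible polynomial of degree [m] is the
    characteristic polynomial of [|GL_m(F)| / (q^m - 1)] matrices and has [m]
    roots in [K], so it remains to count, for each [b], the elements [a] of
    degree [m] for which this quadratic has no root. An injective
    substitution [a -> b^2 + 4 / a] ([q] odd) or [a -> 1 / (b^2 a)] ([q] even,
    [b <> 0]) turns them into the nonsquares of degree [m], resp. the elements
    of degree [m] and absolute trace 1. These are counted by Moebius inversion
    over the subfields of [K]: a subfield of index [k] contains none of them if
    [k] is even, and the subfield's own nonsquares, resp. elements of trace 1,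
    if [k] is odd. *)

(** * Irreducible polynomials over finite fields *)

Lemma reducible_divisor (F : finFieldType) (p : {poly F}) :
    (1 < size p)%N -> ~~ irreducibleb p ->
  exists g, [/\ g %| p, (1 < size g)%N & (size g < size p)%N].
Proof.
move=> p_gt1; rewrite /irreducibleb p_gt1 /= negb_forall => /existsP[g].
rewrite negb_imply -Pdiv.Idomain.dvdpE -ltnNge => /andP[g_dvd g_gt1].
exists g; split=> //; apply: leq_ltn_trans (size_npoly g) _.
by rewrite ltn_predL ltnW.
Qed.

Lemma irreducible_divisor (F : finFieldType) (p : {poly F}) :
  (1 < size p)%N -> exists2 g, irreducible_poly g & g %| p.
Proof.
have [n] := ubnP (size p); elim: n p => // n IH p /ltnSE le_p_n p_gt1.
have [irr_p | /(reducible_divisor p_gt1)[g [g_dvd g_gt1 g_lt]]] :=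
  boolP (irreducibleb p); first by exists p => //; apply/irreducibleP.
have [h irr_h h_dvd] := IH g (leq_trans g_lt le_p_n) g_gt1.
by exists h => //; apply: dvdp_trans g_dvd.
Qed.

(** In a proper factorisation the factor of smaller degree has at most half the degree of [p], and
    each of its irreducible divisors inherits this bound. *)
Lemma small_irreducible_divisor (F : finFieldType) (p : {poly F}) :
    (1 < size p)%N -> ~~ irreducibleb p ->
  exists g, [/\ irreducible_poly g, g %| p & ((size g).-1.*2 <= (size p).-1)%N].
Proof.
move=> p_gt1 /(reducible_divisor p_gt1)[g [/dvdpP[h Dp] g_gt1 g_lt]].
have p_neq0 : p != 0 by rewrite -size_poly_gt0 ltnW.
have [h_neq0 g_neq0] : h != 0 /\ g != 0.
  by move: p_neq0; rewrite Dp mulf_eq0 negb_or => /andP[].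
have sz : (size h + size g = (size p).+1)%N.
  by rewrite Dp size_mul // prednK // ltn_addl // size_poly_gt0.
have h_gt1 : (1 < size h)%N by rewrite -(ltn_add2r (size g)) sz add1n ltnS.
have half (a b : nat) (k : {poly F}) : (size k <= a -> a <= b ->
    b + a = (size p).+1 -> (size k).-1.*2 <= (size p).-1)%N.
  by move: (size k) (size p); lia.
have [le_gh | le_hg] := leqP (size g) (size h).
  have [k irr_k k_dvd] := irreducible_divisor g_gt1.
  exists k; split=> //; first by rewrite Dp dvdp_mull.
  by apply: half (dvdp_leq g_neq0 k_dvd) le_gh _.
have [k irr_k k_dvd] := irreducible_divisor h_gt1.
exists k; split=> //; first by rewrite Dp dvdp_mulr.
by apply: half (dvdp_leq h_neq0 k_dvd) (ltnW le_hg) _; rewrite addnC.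
Qed.

(** Since ['X^#|K| - 'X] is the product of ['X - x] over all [x] in [K], a divisor is, up to a unit,
    such a product over distinct elements. *)
Lemma card_roots_dvd (K : finFieldType) (p : {poly K}) :
  p %| 'X^#|K| - 'X -> #|[set x | root p x]| = (size p).-1.
Proof.
rewrite finField_genPoly -big_enum => /dvdp_prod_XsubC[s p_eqp].
have Us : uniq (mask s (enum K)) by rewrite mask_uniq ?enum_uniq.
rewrite (eqp_size p_eqp) size_prod_XsubC -(card_uniqP Us).
by apply: eq_card => x; rewrite inE (eqp_root p_eqp) root_prod_XsubC.
Qed.

Lemma root_of_dvd (K : finFieldType) (p : {poly K}) :
  p %| 'X^#|K| - 'X -> (1 < size p)%N -> exists x, root p x.
Proof.
move=> /card_roots_dvd p_card p_gt1.
have /card_gt0P[x] : (0 < #|[set x | root p x]|)%N.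
  by rewrite p_card -subn1 subn_gt0.
by rewrite inE; exists x.
Qed.

Lemma irreducible_root_dvd (F K : fieldType) (iota : {rmorphism F -> K})
    (f p : {poly F}) (a : K) :
    irreducible_poly f -> root (map_poly iota f) a -> root (map_poly iota p) a ->
  f %| p.
Proof.
move=> irr_f fa0 pa0; rewrite -[_ %| _]negbK -irreducible_poly_coprime //.
rewrite -(coprimep_map iota); apply/negP => /coprimep_root/(_ fa0).
by rewrite (eqP pa0) eqxx.
Qed.

Lemma size_frobenius_poly (R : nzRingType) n :
  (1 < n)%N -> size ('X^n - 'X : {poly R}) = n.+1.
Proof. by move=> n_gt1; rewrite size_polyDl size_polyXn // size_polyN size_polyX. Qed.

Lemma root_frobenius_poly (R : comNzRingType) n (x : R) :
  root ('X^n - 'X) x = (x ^+ n == x).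
Proof. by rewrite rootE !hornerE subr_eq0. Qed.

Lemma map_frobenius_poly (R S : nzRingType) (iota : {rmorphism R -> S}) n :
  map_poly iota ('X^n - 'X) = 'X^n - 'X.
Proof. by rewrite rmorphB /= map_polyXn map_polyX. Qed.

Lemma finField_adjoin (F : finFieldType) (f : {poly F}) :
    irreducible_poly f ->
  exists (K : finFieldType) (iota : {rmorphism F -> K}) (a : K),
    #|K| = (#|F| ^ (size f).-1)%N /\ root (map_poly iota f) a.
Proof.
move=> /irredp_FAdjoin[L dimL [a fa0 _]].
exists (FinFieldExtType L), (in_alg L), a; split=> //.
rewrite -dimL; have <- := card_vspace (fullv : {vspace finvect_type L}).
by rewrite card_vspacef.
Qed.

(** A root of [f] in the field obtained by adjoining it is also a root of the right-hand polynomial,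
    which an irreducible [f] must then divide. *)
Lemma irreducible_dvd_frobenius (F : finFieldType) (f : {poly F}) :
  irreducible_poly f -> f %| 'X^(#|F| ^ (size f).-1) - 'X.
Proof.
move=> irr_f; have [K [iota [a [cardK fa0]]]] := finField_adjoin irr_f.
apply: irreducible_root_dvd irr_f fa0 _.
by rewrite map_frobenius_poly root_frobenius_poly -cardK expf_card.
Qed.

(** * Degree as the length of a Frobenius orbit *)

Lemma iter_exprn (R : pzSemiRingType) q i (x : R) :
  iter i (fun y => y ^+ q) x = x ^+ (q ^ i).
Proof. by elim: i => //= i ->; rewrite -exprM expnSr. Qed.

Lemma iter_order_dvd (T : finType) (f : T -> T) (x : T) n :
  injective f -> (iter n f x == x) = (fingraph.order f x %| n)%N.
Proof.
move=> inj_f; set o := fingraph.order f x.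
have itero k : iter (k * o) f x = x.
  by elim: k => // k IH; rewrite mulSn iterD IH iter_order.
rewrite {1}(divn_eq n o) addnC iterD itero /dvdn.
have o_gt0 : (0 < o)%N := fingraph.order_gt0 f x.
apply/eqP/eqP => [fx | ->] //.
by rewrite -(findex_iter (ltn_pmod n o_gt0)) fx findex0.
Qed.

Section Frobenius.

Variables (F K : finFieldType) (iota : {rmorphism F -> K}).
Local Notation q := #|F|.

Definition frob (x : K) : K := x ^+ q.

Lemma iter_frob i x : iter i frob x = x ^+ (q ^ i).
Proof. exact: iter_exprn. Qed.

Lemma card_pchar_nat : [pchar K].-nat q.
Proof.
have [p p_pr pF] := finPcharP F.
have pK : p \in [pchar K] by rewrite (fmorph_pchar iota).
rewrite (card_pprimeChar pF) (eq_pnat _ (pcharf_eq pK)).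
by rewrite pnatX pnat_id ?orbT.
Qed.

Lemma frobD x y : frob (x + y) = frob x + frob y.
Proof. exact: exprDn_pchar card_pchar_nat. Qed.

Lemma frob_inj : injective frob.
Proof.
move=> x y eq_xy; apply/eqP; rewrite -subr_eq0.
have : frob (x - y) + frob y = frob y by rewrite -frobD subrK.
move/eqP; rewrite -subr_eq0 addrK expf_eq0 => /andP[] //.
Qed.

Lemma frob_iota a : frob (iota a) = iota a.
Proof. by rewrite /frob -rmorphXn expf_card. Qed.

Lemma horner_iter_frob (g : {poly F}) x i :
  (map_poly iota g).[iter i frob x] = iter i frob (map_poly iota g).[x].
Proof.
elim: i => //= i <-; elim/poly_ind: g (iter i frob x) => [|g c IH] y.
  by rewrite rmorph0 !horner0 /frob expr0n -(ltn_predK (finNzRing_gt1 F)).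
rewrite rmorphD rmorphM /= map_polyX map_polyC /= !hornerE frobD frob_iota IH.
by rewrite /frob exprMn.
Qed.

Lemma root_iter_frob (g : {poly F}) x i :
  root (map_poly iota g) x -> root (map_poly iota g) (iter i frob x).
Proof.
move=> /eqP gx0; rewrite rootE horner_iter_frob gx0.
have := horner_iter_frob 0 0 i; rewrite rmorph0 !horner0 => <-; exact: eqxx.
Qed.

Definition frob_order (x : K) := fingraph.order frob x.

Lemma frob_order_gt0 x : (0 < frob_order x)%N.
Proof. exact: fingraph.order_gt0. Qed.

Lemma frob_order_dvd n x : (frob_order x %| n)%N = (x ^+ (q ^ n) == x).
Proof. by rewrite -iter_order_dvd ?iter_frob //; apply: frob_inj. Qed.

Lemma card_fixed_frob n : (0 < n)%N -> (#|[set x : K | x ^+ (q ^ n) == x]| <= q ^ n)%N.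
Proof.
move=> n_gt0; have qn_gt1 : (1 < q ^ n)%N by rewrite -(exp1n n) ltn_exp2r ?finNzRing_gt1.
have p_neq0 : 'X^(q ^ n) - 'X != 0 :> {poly K}.
  by rewrite -size_poly_gt0 size_frobenius_poly.
rewrite cardE -ltnS -(size_frobenius_poly K qn_gt1) max_poly_roots ?enum_uniq //.
by apply/allP => x; rewrite mem_enum inE root_frobenius_poly.
Qed.

(* The values at [a] of the polynomials of degree below that of [f] are
   pairwise distinct and all fixed by the power of the Frobenius fixing [a]. *)
Lemma frob_order_root (f : {poly F}) a :
  irreducible_poly f -> root (map_poly iota f) a -> frob_order a = (size f).-1.
Proof.
move=> irr_f fa0; set d := (size f).-1; have f_gt1 : (1 < size f)%N := irr_f.1.
have d_gt0 : (0 < d)%N by rewrite /d -subn1 subn_gt0.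
have o_dvd : (frob_order a %| d)%N.
  have := irreducible_dvd_frobenius irr_f.
  rewrite -(dvdp_map iota) map_frobenius_poly frob_order_dvd -root_frobenius_poly.
  by move=> /root_dvdp-> //.
apply/eqP; rewrite eqn_leq dvdn_leq //=.
have q_gt1 := finNzRing_gt1 F.
rewrite -(leq_exp2l _ _ q_gt1).
apply: leq_trans (card_fixed_frob (frob_order_gt0 a)).
pose ev (v : 'rV[F]_d) := (map_poly iota (rVpoly v)).[a].
have ev_inj : injective ev.
  move=> u v eq_uv; apply: (can_inj rVpolyK); apply/eqP; rewrite -subr_eq0.
  apply: contraTT (f_gt1) => uv_neq0.
  have : f %| rVpoly u - rVpoly v.
    apply: irreducible_root_dvd irr_f fa0 _.
    rewrite rmorphB rootE hornerD hornerN; apply/eqP.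
    by rewrite -[X in X - _]/(ev u) eq_uv subrr.
  move=> /(dvdp_leq uv_neq0); rewrite -raddfB leqNgt => /negP[].
  by rewrite (leq_ltn_trans (size_poly _ _)) // ltn_predL ltnW.
have := card_codom ev_inj; rewrite card_mx mul1n => <-.
apply: subset_leq_card; apply/subsetP => _ /codomP[v ->].
by rewrite inE -iter_frob -horner_iter_frob iter_order //; apply: frob_inj.
Qed.

End Frobenius.

(** The splitting field of ['X^N - 'X] has exactly [N] elements: the [N] roots are distinct and
    already form a subfield. *)
Lemma finField_extension (F : finFieldType) m : (0 < m)%N ->
  exists (K : finFieldType) (iota : {rmorphism F -> K}), #|K| = (#|F| ^ m)%N.
Proof.
move=> m_gt0; set N := (#|F| ^ m)%N.
have N_gt1 : (1 < N)%N by rewrite -(exp1n m) ltn_exp2r ?finNzRing_gt1.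
have p_neq0 : 'X^N - 'X != 0 :> {poly F} by rewrite -size_poly_gt0 size_frobenius_poly.
have [L [zs]] := FinSplittingFieldFor p_neq0.
rewrite [map_poly _ _]map_frobenius_poly => Dzs gen_zs.
have [p p_pr pF] := finPcharP F.
have N0 : N%:R = 0 :> L.
  have pL : p \in [pchar L] by rewrite pchar_lalg.
  rewrite /N (card_pprimeChar pF) natrX natrX (pcharf0 pL) -exprM expr0n.
  case: eqP => // n0; move: N_gt1; rewrite /N (card_pprimeChar pF) -expnM.
  by rewrite n0.
(* The polynomial is separable because [N] vanishes in [L], so that its derivative is [-1]. *)
have Uzs : uniq zs.
  rewrite -separable_prod_XsubC -(eqp_separable Dzs) separable_poly.unlock.
  rewrite derivB derivXn derivX -mulr_natl -polyC_natr N0 mul0r sub0r.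
  by rewrite -[X in coprimep _ X]scaleN1r coprimepZr ?coprimep1 // oppr_eq0 oner_eq0.
(* Here [a] is the Frobenius automorphism over [F]; the roots [zs] are the fixed points of its
   [m]-th power. *)
have /finField_galois_generator[a _ Da] : (1 <= {:L})%VS by apply: sub1v.
have Dam x : (a ^+ m)%g x = x ^+ N.
  rewrite /N; elim: (m) => [|i IH]; first by rewrite gal_id.
  by rewrite expgSr galM ?memvf // IH expnSr exprM Da ?memvf // dimv1 expn1.
have in_zs x : (x \in zs) = (x \in fixedSpace (a ^+ m)%g).
  rewrite -root_prod_XsubC -(eqp_root Dzs) root_frobenius_poly -Dam.
  exact: (sameP eqP fixedSpaceP).
(* The fixed points form a subfield containing the roots, and the roots generate [L]. *)
have fix_all : fixedSpace (a ^+ m)%g = {:L}%VS.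
  apply/eqP; rewrite eqEsubv subvf -gen_zs -[fixedSpace _]subfield_closed agenvS //.
  by rewrite subv_add sub1v; apply/span_subvP => z; rewrite in_zs.
exists (FinFieldExtType L), (in_alg L).
transitivity (size zs); last first.
  apply: succn_inj.
  by rewrite -(size_prod_XsubC zs id) -(eqp_size Dzs) size_frobenius_poly.
rewrite -(@card_uniqP (FinFieldExtType L) zs Uzs).
by apply: eq_card => z; rewrite in_zs fix_all memvf.
Qed.

(* Taking [g] of degree 2 shows that the values of [g] are exactly the roots
   of [p] as soon as [p \Po g] splits. *)
Lemma root_comp_dvd (K : finFieldType) (p g : {poly K}) x :
    p \Po g %| 'X^#|K| - 'X -> (1 < size g)%N -> root p x ->
  exists w, g.[w] = x.
Proof.
move=> pg_dvd g_gt1 px0.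
have gx_dvd : g - x%:P %| 'X^#|K| - 'X.
  apply: dvdp_trans pg_dvd; rewrite -[g - _]/(g - x%:P).
  have -> : g - x%:P = ('X - x%:P) \Po g by rewrite comp_polyB comp_polyX comp_polyC.
  by apply: dvdp_comp_poly; rewrite dvdp_XsubCl.
have [|w /eqP] := root_of_dvd gx_dvd.
  by rewrite size_polyDl // size_polyN size_polyC (leq_ltn_trans (leq_b1 _)).
by rewrite !hornerE => /eqP; rewrite subr_eq0 => /eqP; exists w.
Qed.

Lemma root_irreducible (F : finFieldType) (K : fieldType)
    (iota : {rmorphism F -> K}) (p : {poly F}) x :
    p != 0 -> root (map_poly iota p) x ->
  exists2 g, irreducible_poly g & root (map_poly iota g) x.
Proof.
have [n] := ubnP (size p); elim: n p => // n IH p /ltnSE le_p_n p_neq0 px0.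
have p_gt1 : (1 < size p)%N.
  by rewrite -(size_map_poly iota) (root_size_gt1 _ px0) // map_poly_eq0.
have [irr_p | /(reducible_divisor p_gt1)[g [/dvdpP[h Dp] g_gt1 g_lt]]] :=
  boolP (irreducibleb p); first by exists p => //; apply/irreducibleP.
have [h_neq0 g_neq0] : h != 0 /\ g != 0.
  by move: p_neq0; rewrite Dp mulf_eq0 negb_or => /andP[].
have h_lt : (size h < size p)%N.
  have sz : (size h + size g = (size p).+1)%N.
    by rewrite Dp size_mul // prednK // ltn_addl // size_poly_gt0.
  by rewrite -(ltn_add2r (size g)) sz -addn1 ltn_add2l.
move: px0; rewrite Dp rmorphM rootM => /orP[hx0 | gx0].
  by apply: IH hx0 => //; apply: leq_trans le_p_n.
by apply: IH gx0 => //; apply: leq_trans le_p_n.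
Qed.

Lemma finField_root_extension (F : finFieldType) (p : {poly F}) :
    (1 < size p)%N ->
  exists (K : finFieldType) (iota : {rmorphism F -> K}) (a : K) d,
    [/\ (0 < d < size p)%N, #|K| = (#|F| ^ d)%N & root (map_poly iota p) a].
Proof.
move=> p_gt1; have [g irr_g g_dvd] := irreducible_divisor p_gt1.
have [K [iota [a [cardK ga0]]]] := finField_adjoin irr_g.
have p_neq0 : p != 0 by rewrite -size_poly_gt0 ltnW.
exists K, iota, a, (size g).-1; split=> //; last first.
  by apply: root_dvdp ga0; rewrite dvdp_map.
have := irr_g.1; rewrite -subn1 subn_gt0 => -> /=.
rewrite subn1; apply: leq_trans (dvdp_leq p_neq0 g_dvd).
by rewrite ltn_predL ltnW ?irr_g.1.
Qed.

(** * Roots and minimal polynomials in the extension of degree [m] *)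

Section RootsInExtension.

Variables (F K : finFieldType) (iota : {rmorphism F -> K}) (m : nat).
Hypotheses (m_gt0 : (0 < m)%N) (cardK : #|K| = (#|F| ^ m)%N).

Lemma irreducible_splits (f : {poly F}) :
  irreducible_poly f -> (size f).-1 = m -> map_poly iota f %| 'X^#|K| - 'X.
Proof.
move=> irr_f Df; have := irreducible_dvd_frobenius irr_f.
by rewrite -(dvdp_map iota) map_frobenius_poly Df -cardK.
Qed.

Lemma card_roots_irreducible (f : {poly F}) :
    irreducible_poly f -> (size f).-1 = m ->
  #|[set x | root (map_poly iota f) x]| = m.
Proof.
move=> irr_f Df.
by rewrite card_roots_dvd ?irreducible_splits // size_map_poly.
Qed.

(** The Frobenius orbit of [a] consists of roots of [f] and has [m] elements, as many as [f] has
    roots in [K]. *)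
Lemma root_irreducible_conj (f : {poly F}) a b :
    irreducible_poly f -> (size f).-1 = m ->
    root (map_poly iota f) a -> root (map_poly iota f) b ->
  exists i, b = iter i (@frob F K) a.
Proof.
move=> irr_f Df fa0 fb0.
have : fingraph.orbit (@frob F K) a =i [set x | root (map_poly iota f) x].
  apply/subset_cardP.
    rewrite card_roots_irreducible // (card_uniqP (orbit_uniq _ _)) size_orbit.
    by rewrite -Df -(frob_order_root irr_f fa0).
  apply/subsetP => x; rewrite -fconnect_orbit inE => /iter_findex <-.
  exact: root_iter_frob.
move=> /(_ b); rewrite inE fb0 -fconnect_orbit => /iter_findex <-.
by exists (findex (@frob F K) a b).
Qed.

Lemma frob_order_dvd_dim (x : K) : (frob_order F x %| m)%N.
Proof. by rewrite (frob_order_dvd iota) -cardK expf_card. Qed.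

Lemma exists_min_poly (x : K) :
  exists f : {poly F}, [/\ f \is monic, irreducible_poly f,
    root (map_poly iota f) x & (size f).-1 = frob_order F x].
Proof.
have N_gt1 : (1 < #|F| ^ m)%N by rewrite -(exp1n m) ltn_exp2r ?finNzRing_gt1.
have [||g irr_g gx0] := @root_irreducible F K iota ('X^(#|F| ^ m) - 'X) x.
- by rewrite -size_poly_gt0 size_frobenius_poly.
- by rewrite map_frobenius_poly root_frobenius_poly -cardK expf_card.
have g_neq0 := irredp_neq0 irr_g.
have lc_neq0 : (lead_coef g)^-1 != 0 by rewrite invr_eq0 lead_coef_eq0.
exists ((lead_coef g)^-1 *: g); split.
- by rewrite monicE lead_coefZ mulVf // lead_coef_eq0.
- split=> [|h h_neq1]; first by rewrite size_scale // irr_g.1.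
  rewrite dvdpZr // => /(irr_g.2 _ h_neq1) /eqp_trans -> //.
  by rewrite eqp_sym eqp_scale.
- by rewrite map_polyZ rootZ ?fmorph_eq0.
by rewrite size_scale // (frob_order_root irr_g gx0).
Qed.

End RootsInExtension.

(** * The characteristic polynomial of a TSR of order two *)

Lemma char_poly_castmx (R : nzRingType) n n' (e : n = n') (M : 'M[R]_n) :
  char_poly (castmx (e, e) M) = char_poly M.
Proof. by case: n' / e. Qed.

Lemma castmx_sq_inj (T : Type) n n' (e : n = n') :
  injective (castmx (e, e) : 'M[T]_n -> 'M[T]_n').
Proof. by case: n' / e => M N; rewrite !castmx_id. Qed.

(** The recursive splitting of a block matrix leaves a cast on each inner block; all of them
    collapse into one outer cast. *)
Lemma castmx_block (T : Type) m p k (e1 e1' e1'' e1''': m = p) (er er' : m = m)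
    (e2 e2' : (m + p = k)%N)
    (e3 : (m + m = k)%N) (A B C D : 'M[T]_m) :
  castmx (e2, e2') (block_mx A (castmx (er, e1) B)
    (castmx (e1', er') C) (castmx (e1'', e1''') D))
  = castmx (e3, e3) (block_mx A B C D).
Proof.
case: p / e1 in e1' e1'' e1''' e2 e2' *.
rewrite !castmx_id.
by rewrite (eq_irrelevance e2 e3) (eq_irrelevance e2' e3).
Qed.

Lemma addnn_muln2 m : (m + m = m * 2)%N.
Proof. by rewrite muln2 addnn. Qed.

Lemma mxblock22 (T : Type) m (B : 'I_2 -> 'I_2 -> 'M[T]_m)
    (e : (m + m = \sum_(i < 2) m)%N) :
  \mxblock_(i, j) B i j = castmx (e, e) (block_mx (B 0 0) (B 0 1) (B 1 0) (B 1 1)).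
Proof.
have l1 (j : 'I_1) : lift ord0 j = 1 :> 'I_2 by apply: val_inj; rewrite ord1.
rewrite mxblock_recul.
under eq_mxrow do rewrite l1.
under eq_mxcol do rewrite l1.
under eq_mxblock do rewrite !l1.
rewrite (castmx_sym (mxEmxrow (B 0 1))) (castmx_sym (mxEmxcol (B 1 0))).
rewrite (castmx_sym (mxEmxblock (B 1 1))).
exact: castmx_block.
Qed.

Lemma tsr_mx2E (F : finFieldType) m (c : {ffun 'I_2 -> F}) (A : 'M[F]_m) :
  tsr_mx c A = castmx (addnn_muln2 m, addnn_muln2 m)
    (block_mx 0 (c 0 *: A) 1%:M (c 1 *: A)).
Proof.
have e : (m + m = \sum_(i < 2) m)%N by rewrite sum_blocks addnn_muln2.
rewrite /tsr_mx (mxblock22 _ e) castmx_comp /=.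
exact: eq_castmx.
Qed.

Lemma det_scalar_sub_block_mx01 (R : comNzRingType) m (z : R) (B D : 'M[R]_m) :
  \det (z%:M - block_mx 0 B 1%:M D) = \det (z *: (z%:M - D) - B).
Proof.
(* The right factor of [L] turns the upper left block [z] into [z - (z - 1) = 1], and the left one
   clears the [-1] below it. Thus [z] need not be invertible. *)
pose L : 'M[R]_(m + m) := block_mx 1%:M 0 1%:M 1%:M *m block_mx 1%:M (z - 1)%:M 0 1%:M.
have detL : \det L = 1 by rewrite det_mulmx det_lblock det_ublock !det1 !mulr1.
rewrite -[LHS]mul1r -{1}detL -det_mulmx -mulmxA.
rewrite [z%:M]scalar_mx_block opp_block_mx add_block_mx subr0 !sub0r.
rewrite !mulmx_block !mul1mx !mul0mx !add0r !addr0 mulmxN mulmx1 raddfB /= opprB.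
rewrite addrCA subrr addr0 subrr det_ublock det1 mul1r; congr (\det _).
by rewrite mulmxBl mul1mx !mul_scalar_mx -addrA subrK addrC.
Qed.

Lemma horner_char_poly (R : comNzRingType) n (M : 'M[R]_n) z :
  (char_poly M).[z] = \det (z%:M - M).
Proof.
rewrite -/(horner_eval z _) -det_map_mx; congr (\det _).
apply/matrixP => i j; rewrite !mxE /= /horner_eval.
by rewrite hornerD hornerN hornerMn hornerX hornerC.
Qed.

Section TwoBlockCharPoly.

Variables (F : finFieldType) (m : nat).
Implicit Types (c : {ffun 'I_2 -> F}) (A : 'M[F]_m).

Lemma horner_char_poly_tsr (K : fieldType) (iota : {rmorphism F -> K}) c A z :
  (map_poly iota (char_poly (tsr_mx c A))).[z]
    = \det ((z ^+ 2)%:M - (iota (c 1) * z + iota (c 0)) *: map_mx iota A).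
Proof.
rewrite tsr_mx2E char_poly_castmx map_char_poly horner_char_poly map_block_mx.
rewrite map_mx0 map_mx1 !map_mxZ det_scalar_sub_block_mx01; congr (\det _).
rewrite scalerBr scale_scalar_mx -expr2 scalerA -addrA -opprD -scalerDl.
by rewrite [z * _]mulrC.
Qed.

(* Up to a power of [c_1 z + c_0], the determinant is the value of [char_poly A]
   at [z^2 / (c_1 z + c_0)]. *)
Lemma root_char_poly_tsr (K : fieldType) (iota : {rmorphism F -> K}) c A z :
    c 0 != 0 ->
  root (map_poly iota (char_poly (tsr_mx c A))) z
    <-> exists2 a, root (map_poly iota (char_poly A)) a
          & z ^+ 2 = a * (iota (c 1) * z + iota (c 0)).
Proof.
move=> c0_neq0; set w := iota (c 1) * z + iota (c 0).
rewrite rootE horner_char_poly_tsr -/w; split; last first.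
  case=> a; rewrite rootE map_char_poly horner_char_poly => /eqP da0 ->.
  by rewrite mulrC -scale_scalar_mx -scalerBr detZ da0 mulr0.
(* If [w = 0], the vanishing determinant forces [z = 0], whence [c 0 = 0], which is excluded. *)
have [w0 | w_neq0] := eqVneq w 0.
  rewrite w0 scale0r subr0 det_scalar -exprM expf_eq0 => /andP[_ /eqP z0].
  by move: w0; rewrite /w z0 mulr0 add0r => /eqP; rewrite fmorph_eq0 (negPf c0_neq0).
move=> d0; exists (z ^+ 2 / w); last by rewrite divfK.
move: d0; rewrite rootE map_char_poly horner_char_poly.
rewrite -{1}[z ^+ 2](divfK w_neq0) [_ / w * w]mulrC -scale_scalar_mx -scalerBr detZ.
by rewrite mulf_eq0 expf_eq0 (negPf w_neq0) andbF.
Qed.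

Hypothesis m_gt1 : (1 < m)%N.

(** With [c 0 = 0] the polynomial would vanish at [0], an element of degree 1, while its own degree
    is [2 m]. *)
Lemma irreducible_tsr_c0 c A : irreducible_poly (char_poly (tsr_mx c A)) -> c 0 != 0.
Proof.
move=> irr_P; apply/eqP => c0.
have P0 : root (map_poly idfun (char_poly (tsr_mx c A))) 0.
  rewrite rootE (horner_char_poly_tsr idfun) /= c0 mulr0 addr0 scale0r subr0 expr0n.
  by rewrite det_scalar expr0n -(ltn_predK m_gt1).
have := frob_order_root irr_P P0; rewrite size_char_poly /= => o0.
have : (frob_order F (0%R : F) %| 1)%N.
  by rewrite (frob_order_dvd idfun) expn1 expf_card.
by rewrite o0 dvdn1 muln2; case: (m) m_gt1 => [|[]].
Qed.

(* A proper factor of [char_poly A] of degree [d <= m / 2] would give a root of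
   the TSR's characteristic polynomial of degree at most [2 d < 2 m]. *)
Lemma irreducible_tsr_char_poly c A :
  irreducible_poly (char_poly (tsr_mx c A)) -> irreducible_poly (char_poly A).
Proof.
move=> irr_P; have c0_neq0 := irreducible_tsr_c0 irr_P.
have [/irreducibleP // | nirr] := boolP (irreducibleb (char_poly A)).
have [|g [irr_g g_dvd]] := small_irreducible_divisor _ nirr.
  by rewrite size_char_poly ltnS ltnW.
rewrite size_char_poly /= => g_small.
have [L [iota [a [cardL ga0]]]] := finField_adjoin irr_g.
have a0 : root (map_poly iota (char_poly A)) a by apply: root_dvdp ga0; rewrite dvdp_map.
pose Q := 'X^2 - (a * iota (c 1))%:P * 'X - (a * iota (c 0))%:P.
have sQ : size Q = 3.
  rewrite /Q -addrA size_polyDl size_polyXn // -opprD size_polyN.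
  by rewrite size_MXaddC; case: ifP => // _; rewrite !ltnS size_polyC_leq1.
have [|L' [j [z [d [/andP[d_gt0 d_lt] cardL' Qz0]]]]] := @finField_root_extension _ Q.
  by rewrite sQ.
pose iota' : {rmorphism F -> L'} := j \o iota.
have Pz : root (map_poly iota' (char_poly (tsr_mx c A))) z.
  apply/(root_char_poly_tsr iota') => //; exists (j a).
    by rewrite map_poly_comp rootE horner_map (eqP a0) rmorph0.
  move: Qz0; rewrite /Q 2!rmorphB /= map_polyXn [map_poly _ (_ * _)]rmorphM /=.
  rewrite map_polyX !map_polyC /= rootE.
  rewrite !hornerE !rmorphM => /eqP Qz0; rewrite -[LHS]subr0 -Qz0 /=; ring.
(* The degree [2 m] of [z] divides the degree of [L'] over [F], which is [(size g).-1 * d] with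
   [d <= 2], hence positive and at most [m]. *)
have := frob_order_root irr_P Pz; rewrite size_char_poly /= => oz.
have := frob_order_dvd_dim iota' (m := ((size g).-1 * d)%N) _ z.
rewrite cardL' cardL expnM oz => /(_ erefl) /dvdn_leq.
rewrite sQ in d_lt.
have := irr_g.1.
move: (size g) g_small => s; nia.
Qed.

(** A solution [z] in [K] is a root whose degree divides [m], whereas irreducibility demands degree
    [2 m]. Conversely, a reducible polynomial has an irreducible factor of degree at most [m]; this
    degree turns out to be [m], so the factor has a root in [K], and a conjugate of that root solves
    the equation for [a]. *)
Lemma irreducible_tsrP (K : finFieldType) (iota : {rmorphism F -> K}) c A a :
    #|K| = (#|F| ^ m)%N -> c 0 != 0 -> irreducible_poly (char_poly A) ->
    root (map_poly iota (char_poly A)) a ->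
  irreducible_poly (char_poly (tsr_mx c A))
    <-> forall z, z ^+ 2 <> a * (iota (c 1) * z + iota (c 0)).
Proof.
move=> cardK c0_neq0 irr_f fa0; have m_gt0 := ltnW m_gt1.
have sf : (size (char_poly A)).-1 = m by rewrite size_char_poly.
split=> [irr_P z Dz | no_z].
  have Pz : root (map_poly iota (char_poly (tsr_mx c A))) z.
    by apply/(root_char_poly_tsr iota) => //; exists a.
  have := frob_order_dvd_dim iota cardK z.
  rewrite (frob_order_root irr_P Pz) size_char_poly /= => /dvdn_leq.
  by move/(_ m_gt0); rewrite leqNgt -[X in (X < _)%N]muln1 ltn_pmul2l.
have [/irreducibleP // | nirr] := boolP (irreducibleb (char_poly (tsr_mx c A))).
have [|g [irr_g g_dvd]] := small_irreducible_divisor _ nirr.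
  by rewrite size_char_poly ltnS muln_gt0 m_gt0.
rewrite size_char_poly /= => g_half.
have g_small : ((size g).-1 <= m)%N by rewrite -leq_double -[leqRHS]muln2.
have [L [j [y [cardL gy0]]]] := finField_adjoin irr_g.
have /(root_char_poly_tsr j) : root (map_poly j (char_poly (tsr_mx c A))) y.
  by apply: root_dvdp gy0; rewrite dvdp_map.
case=> // b fb0 _.
(* The field [L] of degree [(size g).-1] contains [b], which has degree [m]. *)
have sg : (size g).-1 = m.
  apply/eqP; rewrite eqn_leq g_small /= -{1}sf -(frob_order_root irr_f fb0).
  by rewrite dvdn_leq ?(frob_order_dvd_dim j cardL) // -subn1 subn_gt0 irr_g.1.
have [|z gz0] := root_of_dvd (irreducible_splits iota cardK irr_g sg).
  by rewrite size_map_poly irr_g.1.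
have /(root_char_poly_tsr iota) : root (map_poly iota (char_poly (tsr_mx c A))) z.
  by apply: root_dvdp gz0; rewrite dvdp_map.
case=> // b' fb'0 Dz.
(* The Frobenius power taking [b'] to [a] takes the solution [z] for [b'] to a solution for [a],
   since the [c i] lie in [F]. *)
have [i Da] := root_irreducible_conj cardK irr_f sf fb'0 fa0.
case: (no_z (iter i (@frob F K) z)).
pose p : {poly F} := (c 1) *: 'X + (c 0)%:P.
have ev x : (map_poly iota p).[x] = iota (c 1) * x + iota (c 0).
  by rewrite /p rmorphD /= map_polyZ map_polyX map_polyC !hornerE.
by rewrite -ev horner_iter_frob ev Da !iter_frob -exprMn -Dz exprAC.
Qed.

End TwoBlockCharPoly.

(** * Matrices with a given irreducible characteristic polynomial *)

Lemma char_poly_companion (R : comNzRingType) (f : {poly R}) d :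
    f \is monic -> d = (size f).-1 ->
  char_poly (\matrix_(i < d, j < d)
    (if i == d.-1 :> nat then - f`_j else (i.+1 == j)%:R)) = f.
Proof. by move=> f_monic ->; apply: companionmxK. Qed.

Section CompanionCount.

Variables (F : finFieldType) (n : nat) (f : {poly F}).
Local Notation m := n.+1.
Hypotheses (f_monic : f \is monic) (irr_f : irreducible_poly f) (sf : size f = m.+1).

(** The companion matrix of [f], acting on row vectors: multiplication by ['X] modulo [f] in the
    basis of powers of ['X]. *)
Let C : 'M[F]_m := \matrix_(i, j) (if i == n :> nat then - f`_j else (i.+1 == j)%:R).

Let char_poly_C : char_poly C = f.
Proof. by rewrite -[RHS](@char_poly_companion _ f m) // sf. Qed.

Definition krylov (A : 'M[F]_m) (v : 'rV[F]_m) : 'M[F]_m := \matrix_i (v *m A ^+ i).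

Lemma mul_krylov A v (u : 'rV_m) : u *m krylov A v = v *m horner_mx A (rVpoly u).
Proof.
rewrite mulmx_sum_row [rVpoly u]poly_def raddf_sum /= mulmx_sumr.
apply: eq_bigr => i _; rewrite rowK linearZ /= rmorphXn /= horner_mx_X -scalemxAr.
by congr (_ *: _); rewrite insubT //= => lt_i; congr (u 0 _); apply: val_inj.
Qed.

(** A linear relation between the rows is a polynomial [p] of degree below [m] with [v *m p(A) = 0].
    If [p] is nonzero it is coprime to [f], and Bezout with Cayley-Hamilton gives [v = 0]. *)
Lemma krylov_unit A v : char_poly A = f -> v != 0 -> krylov A v \in unitmx.
Proof.
move=> Af v_neq0; rewrite -row_free_unit; apply: inj_row_free => u.
rewrite mul_krylov => vp0; apply: contraNeq v_neq0 => u_neq0.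
set p := rVpoly u in vp0; have p_neq0 : p != 0.
  by apply: contra_neq u_neq0 => p0; rewrite -[u]rVpolyK -/p p0 linear0.
have : coprimep f p.
  rewrite irreducible_poly_coprime //; apply: contraL (size_poly _ _ : (size p <= m)%N).
  by move=> /(dvdp_leq p_neq0); rewrite sf -ltnNge.
case/Bezout_eq1_coprimepP => -[r s] /= Drs.
have : v *m horner_mx A (r * f + s * p) = 0.
  rewrite (mulrC s) rmorphD !rmorphM /= -Af Cayley_Hamilton mulr0 add0r.
  by rewrite -[_ * _]/(_ *m _) mulmxA vp0 mul0mx.
by rewrite Drs rmorph1 mulmx1 => ->.
Qed.

Lemma krylov_companion A v : char_poly A = f -> krylov A v *m A = C *m krylov A v.
Proof.
move=> Af; apply/row_matrixP => i; rewrite !row_mul rowK -mulmxA.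
rewrite -[A ^+ i *m A]/(A ^+ i * A) -exprSr.
have [i_n | i_neq_n] := eqVneq (i : nat) n; last first.
  have lt_i : (i.+1 < m)%N by rewrite ltnS ltn_neqAle i_neq_n -ltnS /=.
  have -> : row i C = delta_mx 0 (Ordinal lt_i).
    by apply/rowP => j; rewrite !mxE (negPf i_neq_n) eq_sym.
  by rewrite -rowE rowK.
have Af0 : horner_mx A f = 0 by rewrite -Af Cayley_Hamilton.
rewrite mul_krylov i_n; congr (v *m _).
(* The last row of [C] holds the coefficients of ['X^m] reduced modulo [f], so Cayley-Hamilton
   settles this row. *)
have Df : f = 'X^m - rVpoly (row i C).
  apply/polyP => k; rewrite coefB coefXn coef_rVpoly.
  case: insubP => [j /= lt_k <- | ]; last first.
    rewrite -leqNgt leq_eqVlt => /orP[/eqP <- | gt_k].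
      by rewrite eqxx subr0; have := f_monic; rewrite monicE lead_coefE sf => /eqP.
    by rewrite gtn_eqF // subr0 nth_default // sf.
  by rewrite !mxE i_n eqxx opprK ltn_eqF // add0r.
move: Af0; rewrite Df rmorphB rmorphXn /= horner_mx_X => /eqP.
by rewrite subr_eq0 => /eqP.
Qed.

Lemma delta_mul_companion (i : 'I_m) : delta_mx 0 0 *m C ^+ i = delta_mx 0 i :> 'rV_m.
Proof.
case: i => i lt_i /=; elim: i lt_i => [|i IH] lt_i.
  by rewrite expr0 mulmx1; congr delta_mx; apply: val_inj.
rewrite exprSr -[_ * _]/(_ *m _) mulmxA (IH (ltnW lt_i)) -rowE.
by apply/rowP => j; rewrite !mxE /= ltn_eqF // eq_sym.
Qed.

(** The inverse of [krylov]: the operator with matrix [C] in the basis of the rows of [P], and the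
    first vector of that basis. *)
Let conj_pair (P : 'M[F]_m) := (invmx P *m C *m P, row 0 P).

Let krylov_conj P : P \in unitmx ->
  krylov (conj_pair P).1 (conj_pair P).2 = P.
Proof.
move=> Pu; apply/row_matrixP => i; rewrite rowK /=.
have -> : (invmx P *m C *m P) ^+ i = invmx P *m C ^+ i *m P.
  elim: (i : nat) => [|k IH]; first by rewrite !expr0 mulmx1 mulVmx.
  rewrite !exprSr IH -![_ * _]/(_ *m _) !mulmxA.
  by congr (_ *m _ *m _); rewrite -[RHS]mulmx1 -(mulmxV Pu) !mulmxA.
rewrite rowE !mulmxA -(mulmxA (delta_mx _ _)) mulmxV // mulmx1.
by rewrite delta_mul_companion -rowE.
Qed.

(* Pairs of a matrix with characteristic polynomial [f] and a nonzero (hence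
   cyclic) vector correspond to invertible matrices: the basis in which the
   matrix becomes the companion matrix and the vector the first basis vector. *)
Lemma card_char_poly :
  (#|[set A : 'M[F]_m | char_poly A == f]| * (#|F| ^ m - 1))%N = #|'GL_m[F]%g|.
Proof.
have card_v : (#|F| ^ m - 1)%N = #|[set~ (0 : 'rV[F]_m)]|.
  by rewrite cardsC1 card_mx mul1n subn1.
rewrite card_v -cardsX.
have -> : #|'GL_m[F]%g| = #|[set P : 'M[F]_m | P \in unitmx]|.
  by rewrite cardsT /= card_sub; apply: eq_card => P; rewrite !inE.
have conj_inj : {in [set P : 'M[F]_m | P \in unitmx] &, injective conj_pair}.
  move=> P Q; rewrite !inE => Pu Qu eqPQ.
  by rewrite -(krylov_conj Pu) eqPQ krylov_conj.
rewrite -(card_in_imset conj_inj); apply: eq_card => -[A v].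
rewrite !inE /=; apply/andP/imsetP => [[/eqP Af v_neq0] | [P]].
  have Ku := krylov_unit Af v_neq0.
  exists (krylov A v); first by rewrite inE.
  rewrite /conj_pair -mulmxA -krylov_companion // mulmxA mulVmx // mul1mx.
  by rewrite rowK expr0 mulmx1.
rewrite inE => Pu [-> ->]; split; last first.
  rewrite rowE; apply: contraTneq isT => P0; have := congr1 (mulmx^~ (invmx P)) P0.
  rewrite -mulmxA mulmxV // mulmx1 mul0mx => /matrixP/(_ 0 0).
  by rewrite !mxE !eqxx => /eqP; rewrite oner_eq0.
have VP : map_mx polyC (invmx P) *m map_mx polyC P = 1%:M.
  by rewrite -(map_mxM polyC) mulVmx // map_mx1.
apply/eqP; rewrite -[RHS]char_poly_C /char_poly.
have -> : char_poly_mx (invmx P *m C *m P) =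
    map_mx polyC (invmx P) *m char_poly_mx C *m map_mx polyC P.
  rewrite /char_poly_mx !(map_mxM polyC) mulmxBr mulmxBl; congr (_ - _).
  by rewrite scalar_mxC -mulmxA VP mulmx1.
by rewrite !det_mulmx mulrAC -det_mulmx VP det1 mul1r.
Qed.

End CompanionCount.

(** * Moebius inversion over the subfields *)

Lemma mobius_primeM p e : prime p -> (0 < e)%N ->
  mobius (p * e) = if (p %| e)%N then 0 else - mobius e.
Proof.
move=> p_pr e_gt0; have p_gt0 := prime_gt0 p_pr.
rewrite /mobius muln_gt0 p_gt0 e_gt0 /=.
have [p_e | p_ndvd] := boolP (p %| e)%N.
  case: allP => // /(_ p); rewrite mem_primes p_pr muln_gt0 p_gt0 e_gt0.
  rewrite dvdn_mulr // lognM // lognE p_pr p_gt0 dvdnn divnn p_gt0 logn1 => /(_ isT).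
  by rewrite eqSS -leqn0 leqNgt logn_gt0 mem_primes p_pr e_gt0 p_e.
have pr_pe : perm_eq (primes (p * e)) (p :: primes e).
  apply: uniq_perm; rewrite ?primes_uniq //=.
    by rewrite mem_primes (negPf p_ndvd) !andbF primes_uniq.
  move=> r; rewrite primesM // inE; congr (_ || _).
  by rewrite primes_prime // inE.
rewrite (perm_all _ pr_pe) (perm_size pr_pe) /= exprS mulN1r.
have -> : (logn p (p * e) == 1)%N.
  rewrite lognM // lognE p_pr p_gt0 dvdnn divnn p_gt0 logn1.
  by rewrite eqSS -leqn0 leqNgt logn_gt0 mem_primes (negPf p_ndvd) !andbF.
rewrite andTb (@eq_in_all _ _ (fun r => logn r e == 1)%N); last first.
  move=> r r_e; rewrite lognM // (logn_prime _ p_pr) eqn_leq.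
  have -> : (r == p) = false.
    by apply: contraNF p_ndvd => /eqP <-; move: r_e; rewrite mem_primes => /and3P[].
  by rewrite add0n -eqn_leq.
by case: all; rewrite ?oppr0.
Qed.

(** For [e] prime to [p], the terms at [e] and [p * e] cancel; when [p] divides [e], the term at
    [p * e] is zero. The predicate [P] covers both the sum over all divisors and the sum over odd
    ones. *)
Lemma sum_mobius_prime (P : pred nat) p n :
    prime p -> (0 < n)%N -> (p %| n)%N -> (forall d, P (p * d)%N = P d) ->
  \sum_(d <- divisors n | P d) mobius d = 0.
Proof.
move=> p_pr n_gt0 /dvdnP[k Dn] Pp; have p_gt0 := prime_gt0 p_pr.
have k_gt0 : (0 < k)%N by move: n_gt0; rewrite Dn muln_gt0 => /andP[].
rewrite (bigID (fun d => (p %| d)%N)) /=.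
have -> : \sum_(d <- divisors n | P d && (p %| d)%N) mobius d
    = \sum_(e <- divisors k | P e) mobius (p * e).
  rewrite -big_filter.
  pose multiples := map (muln p) [seq e <- divisors k | P e].
  transitivity (\sum_(d <- multiples) mobius d); last first.
    by rewrite big_map big_filter.
  apply: perm_big; apply: uniq_perm.
  - by rewrite filter_uniq ?divisors_uniq.
  - rewrite map_inj_uniq ?filter_uniq ?divisors_uniq //.
    by move=> x y /eqP; rewrite eqn_pmul2l // => /eqP.
  move=> d; rewrite mem_filter -dvdn_divisors //; apply/andP/mapP.
    case=> /andP[Pd /dvdnP[e De]] d_n; exists e; last by rewrite mulnC.
    rewrite mem_filter -dvdn_divisors // -Pp mulnC -De Pd /=.
    by move: d_n; rewrite De Dn dvdn_pmul2r.
  case=> e; rewrite mem_filter -dvdn_divisors // => /andP[Pe e_k] ->.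
  by rewrite Pp Pe dvdn_mulr // Dn mulnC dvdn_pmul2r.
have -> : \sum_(d <- divisors n | P d && ~~ (p %| d)%N) mobius d
    = \sum_(e <- divisors k | P e && ~~ (p %| e)%N) mobius e.
  rewrite -big_filter -[RHS]big_filter; apply: perm_big; apply: uniq_perm.
  - by rewrite filter_uniq ?divisors_uniq.
  - by rewrite filter_uniq ?divisors_uniq.
  move=> d; rewrite !mem_filter -!dvdn_divisors // -!andbA; congr (_ && _).
  have [//|p_ndvd /=] := boolP (p %| d)%N.
  by rewrite Dn Gauss_dvdl // coprime_sym prime_coprime.
rewrite [X in X + _](bigID (fun d => (p %| d)%N)) /=.
have gt0 e : e \in divisors k -> (0 < e)%N.
  by rewrite -dvdn_divisors // => /dvdn_gt0 ->.
rewrite big_seq_cond big1 => [|e /and3P[/gt0 e_gt0 _ p_e]]; last first.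
  by rewrite mobius_primeM // p_e.
rewrite add0r -big_split big_seq_cond big1 // => e /and3P[/gt0 e_gt0 _ /negPf p_e].
by rewrite /= mobius_primeM // p_e addNr.
Qed.

Lemma sum_mobius n : (0 < n)%N -> \sum_(d <- divisors n) mobius d = (n == 1%N).
Proof.
move=> n_gt0; have [-> | n_neq1] := eqVneq n 1%N; first by rewrite big_seq1.
apply: (@sum_mobius_prime xpredT (pdiv n)) => //; last exact: pdiv_dvd.
by rewrite pdiv_prime // ltn_neqAle eq_sym n_neq1.
Qed.

Section FullOrderCount.

Variables (F K : finFieldType) (iota : {rmorphism F -> K}) (m : nat).
Hypotheses (m_gt0 : (0 < m)%N) (cardK : #|K| = (#|F| ^ m)%N).
Local Notation q := #|F|.

(** With [e] the degree of [x], the indicator requires [e] to divide [m %/ d], that is, [d] to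
    divide [m %/ e]; what remains is the full Moebius sum of [m %/ e]. *)
Lemma frob_order_mobius (x : K) :
  (frob_order F x == m)%:R =
  \sum_(d <- divisors m) mobius d * (x ^+ (q ^ (m %/ d)) == x)%:R :> int.
Proof.
have e_m := frob_order_dvd_dim iota cardK x; set e := frob_order F x in e_m *.
have e_gt0 : (0 < e)%N := frob_order_gt0 F x.
have -> : (e == m) = (m %/ e == 1)%N.
  by rewrite -{1}(divnK e_m) -{1}[e]mul1n eqn_pmul2r // eq_sym.
have me_gt0 : (0 < m %/ e)%N by rewrite divn_gt0 // dvdn_leq.
rewrite natz -sum_mobius //.
rewrite [RHS](eq_bigr (fun d => if (e %| m %/ d)%N then mobius d else 0)); last first.
  move=> d _; rewrite -(frob_order_dvd iota) -/e.
  by case: ifP; rewrite ?mulr1 ?mulr0.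
rewrite -[RHS]big_mkcond -[RHS]big_filter; apply: perm_big; apply: uniq_perm.
- exact: divisors_uniq.
- by rewrite filter_uniq ?divisors_uniq.
move=> d; rewrite mem_filter -!dvdn_divisors //.
apply/idP/andP => [d_me | [e_md d_m]].
  have d_m : (d %| m)%N by apply: dvdn_trans d_me _; apply: dvdn_div.
  by split=> //; rewrite dvdn_divRL // mulnC -dvdn_divRL.
by rewrite dvdn_divRL // mulnC -dvdn_divRL.
Qed.

(** Used with [eps = 1] for nonsquares and [eps = 0] for elements of trace 1. The divisor [d] stands
    for the subfield of index [d], so only odd [d] survive. *)
Lemma card_full_order (H : {set K}) (eps : rat) :
    (forall d, (d %| m)%N -> 2 * #|[set x in H | x ^+ (q ^ d) == x]|%:R
       = if odd (m %/ d) then q%:R ^+ d - eps else 0 :> rat) ->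
  2 * #|[set x in H | frob_order F x == m]|%:R
    = \sum_(d <- divisors m | odd d) (mobius d)%:~R * (q%:R ^+ (m %/ d) - eps) :> rat.
Proof.
move=> cardH.
have -> : #|[set x in H | frob_order F x == m]|%:R
    = \sum_(d <- divisors m) (mobius d)%:~R *
        #|[set x in H | x ^+ (q ^ (m %/ d)) == x]|%:R :> rat.
  have cardE (P : pred K) : #|[set x in H | P x]|%:R = \sum_(x in H) (P x)%:R :> rat.
    rewrite -sum1_card natr_sum big_mkcond [RHS]big_mkcond; apply: eq_bigr => x _.
    by rewrite !inE; case: (x \in H); case: (P x).
  rewrite cardE.
  under [RHS]eq_bigr do rewrite cardE mulr_sumr.
  rewrite exchange_big /=; apply: eq_bigr => x _.
  have /(congr1 (intr : int -> rat)) := frob_order_mobius x.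
  rewrite rmorph_nat => ->; rewrite rmorph_sum /=; apply: eq_bigr => d _.
  by rewrite intrM rmorph_nat.
rewrite mulr_sumr [RHS]big_mkcond /= big_seq [RHS]big_seq; apply: eq_bigr => d.
rewrite -dvdn_divisors // => d_m.
rewrite mulrCA cardH; last by rewrite -{2}(divnK d_m) dvdn_mulr.
have -> : (m %/ (m %/ d) = d)%N by rewrite divnA ?mulKn.
by case: ifP; rewrite ?mulr0.
Qed.

End FullOrderCount.

(** * Nonsquares and elements of trace 1 *)

Lemma frobenius_poly_dvd (R : idomainType) N k :
  ('X^N - 'X : {poly R}) %| 'X^(N ^ k) - 'X.
Proof.
elim: k => [|k IH]; first by rewrite expr1 subrr dvdp0.
have -> : 'X^(N ^ k.+1) - 'X = ('X^(N ^ k) ^+ N - 'X^N) + ('X^N - 'X) :> {poly R}.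
  by rewrite addrA subrK expnSr exprM.
by rewrite dvdp_addl // subrXX dvdp_mulr.
Qed.

Section OddHalf.

Variables (F K : finFieldType) (iota : {rmorphism F -> K}) (m : nat).
Hypotheses (m_gt0 : (0 < m)%N) (cardK : #|K| = (#|F| ^ m)%N) (odd_q : odd #|F|).
Local Notation q := #|F|.

Lemma odd_two_neq0 : 2%:R != 0 :> K.
Proof.
apply/negP => K2; have pK : 2%N \in [pchar K] by rewrite inE.
have := card_pchar_nat iota; rewrite (eq_pnat _ (pcharf_eq pK)).
move=> /p_natP[[|k] Dq]; have := finNzRing_gt1 F; rewrite Dq //.
by move: odd_q; rewrite Dq oddX.
Qed.

Definition nonsquares := [set x : K | [forall z : K, z ^+ 2 != x]].

Lemma odd_pow_half n : (q ^ n = ((q ^ n).-1./2).*2.+1)%N.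
Proof. by have := oddX q n; rewrite odd_q orbT; lia. Qed.

(** Euler's criterion. If [x ^+ h = 1], then [x] is a square because ['X^h - 1] composed with ['X^2]
    divides ['X^#|K| - 'X]. *)
Lemma nonsquareP x : (x \in nonsquares) = (x ^+ (#|K|.-1./2) == -1).
Proof.
set h := _./2; have DK : #|K| = h.*2.+1 by rewrite /h cardK -odd_pow_half.
have h_gt0 : (0 < h)%N by have := finNzRing_gt1 K; rewrite DK; case: (h).
have m1_neq1 : 1 != -1 :> K by rewrite -subr_eq0 opprK odd_two_neq0.
have pow_h (y : K) : y != 0 -> y ^+ h.*2 = 1.
  by move=> y_neq0; apply: (mulfI y_neq0); rewrite mulr1 -exprS -DK expf_card.
rewrite inE; apply/forallP/eqP => [nsq | xh z]; last first.
  apply/eqP => zx; move: xh; rewrite -zx -exprM mul2n.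
  have [-> | /pow_h ->] := eqVneq z 0; last by move/eqP; rewrite (negPf m1_neq1).
  rewrite expr0n double_eq0 -leqn0 leqNgt h_gt0 => /esym/eqP.
  by rewrite oppr_eq0 oner_eq0.
have x_neq0 : x != 0 by apply: contraTneq (nsq 0) => ->; rewrite expr0n eqxx.
have /eqP : x ^+ h ^+ 2 = 1 by rewrite -exprM muln2 pow_h.
rewrite sqrf_eq1 => /orP[/eqP xh | /eqP //].
have [|||w] := @root_comp_dvd K ('X^h - 1) 'X^2 x.
- rewrite comp_polyB comp_Xn_poly comp_polyC -exprM mul2n DK.
  by apply/dvdpP; exists 'X; rewrite mulrBr mulr1 -exprS.
- by rewrite size_polyXn.
- by rewrite rootE !hornerE xh subrr.
by rewrite hornerXn => wx; move: (nsq w); rewrite wx eqxx.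
Qed.

(** On the subfield with [N] elements the exponent in Euler's criterion is [h * S], where [h] is
    half of [N - 1] and [S], a sum of [k] odd powers, has the parity of [k]. Hence the criterion
    fails for even [k] and reads [x ^+ h = -1] for odd [k], which has [h] solutions. *)
Lemma card_nonsquares_fixed d : (d %| m)%N ->
  2 * #|[set x in nonsquares | x ^+ (q ^ d) == x]|%:R
    = if odd (m %/ d) then q%:R ^+ d - 1 else 0 :> rat.
Proof.
move=> d_m; set k := (m %/ d)%N; have Dm : m = (d * k)%N by rewrite mulnC divnK.
set N := (q ^ d)%N; set h := (N.-1./2)%N; have DN : N = h.*2.+1 := odd_pow_half d.
have cardK' : #|K| = (N ^ k)%N by rewrite cardK Dm expnM.
pose S := (\sum_(i < k) N ^ i)%N.
have DS : (#|K|.-1./2 = h * S)%N.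
  by rewrite cardK' predn_exp -/S DN /= -muln2 mulnAC muln2 doubleK.
have oddS : odd S = odd k.
  rewrite /S; elim: (k) => [|j IH]; first by rewrite big_ord0.
  by rewrite big_ord_recr /= oddD IH oddX DN /= odd_double orbT addbT.
have h_gt0 : (0 < h)%N.
  have d_gt0 : (0 < d)%N by apply: dvdn_gt0 d_m.
  have : (1 < N)%N by rewrite -(exp1n d) ltn_exp2r ?finNzRing_gt1.
  by rewrite DN; case: (h).
have m1_neq1 : 1 != -1 :> K by rewrite -subr_eq0 opprK odd_two_neq0.
have pow_h (x : K) : x != 0 -> x ^+ N = x -> x ^+ h ^+ 2 = 1.
  by move=> x_neq0 xN; apply: (mulfI x_neq0); rewrite mulr1 -exprM muln2 -exprS -DN.
have nonsqE x : x ^+ N = x -> (x \in nonsquares) = odd k && (x ^+ h == -1).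
  move=> xN; rewrite nonsquareP DS exprM.
  have [-> | x_neq0] := eqVneq x 0.
    have m1_neq0 : (0 == -1 :> K) = false by rewrite eq_sym oppr_eq0 oner_eq0.
    rewrite [0 ^+ h]expr0n gtn_eqF // m1_neq0 andbF expr0n.
    by case: (S == 0%N); rewrite ?(negPf m1_neq1).
  rewrite -[S]odd_double_half exprD -mul2n exprM pow_h // expr1n mulr1 oddS.
  by case: (odd k); rewrite ?expr1 // expr0 (negPf m1_neq1).
have [odd_k | even_k] := boolP (odd k); last first.
  rewrite (_ : [set x in _ | _] = set0) ?cards0 ?mulr0 //.
  apply/setP => x; rewrite in_set in_set0; apply: negbTE; apply/andP => -[x_nsq /eqP xN].
  by move: x_nsq; rewrite nonsqE // (negPf even_k).
have -> : [set x in nonsquares | x ^+ N == x] = [set x | root ('X^h + 1) x].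
  apply/setP => x; rewrite in_set [in RHS]in_set rootE !hornerE addr_eq0.
  apply/andP/eqP => [[x_nsq /eqP xN] | xh].
    by move: x_nsq; rewrite nonsqE // odd_k => /eqP.
  have xN : x ^+ N = x by rewrite DN exprS -muln2 exprM xh sqrrN expr1n mulr1.
  by rewrite nonsqE // odd_k xh xN !eqxx.
rewrite card_roots_dvd; last first.
  apply: (@dvdp_trans _ ('X^N - 'X)); last by rewrite cardK' frobenius_poly_dvd.
  apply/dvdpP; exists ('X * ('X^h - 1)).
  by rewrite -mulrA -subr_sqr expr1n -exprM muln2 mulrBr mulr1 -exprS -DN.
rewrite size_polyDl ?size_polyXn ?size_poly1 //=.
by rewrite -natrX -/N DN -natrM -natr1 addrK mul2n.
Qed.

End OddHalf.

(** * The absolute trace in characteristic two *)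

Section Trace2.

(** On the field with [2 ^ s] elements this is the trace to the prime field. A general ring allows
    it to be evaluated at ['X] as well, giving the trace polynomial. *)
Definition trace2 (R : nzRingType) s (x : R) := \sum_(i < s) x ^+ (2 ^ i).

Variables (R : comNzRingType) (R2 : 2%N \in [pchar R]).

Let sqrD s (x y : R) : (x + y) ^+ (2 ^ s) = x ^+ (2 ^ s) + y ^+ (2 ^ s).
Proof. by apply: exprDn_pchar; rewrite (eq_pnat _ (pcharf_eq R2)) pnatX pnat_id. Qed.

Lemma trace2_artin_schreier s (x : R) : trace2 s (x ^+ 2 + x) = x ^+ (2 ^ s) + x.
Proof.
rewrite /trace2; elim: s => [|s IH]; first by rewrite big_ord0 expr1 addrr_pchar2.
rewrite big_ord_recr /= IH sqrD -exprM -expnS addrC addrA -(addrA (x ^+ _)).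
by rewrite addrr_pchar2 // addr0.
Qed.

Lemma artin_schreier_trace2 s (x : R) :
  trace2 s x ^+ 2 + trace2 s x = x ^+ (2 ^ s) + x.
Proof.
rewrite -trace2_artin_schreier; rewrite /trace2; elim: s => [|s IH].
  by rewrite !big_ord0 expr0n addr0.
rewrite !big_ord_recr /= -IH sqrD (sqrD 1 : forall y z, (y + z) ^+ 2 = _).
rewrite -!exprM [(2 * _)%N]mulnC.
by rewrite addrACA.
Qed.

(** The powers repeat with period [s], so the trace is [k] times the trace over one period, and [k]
    counts modulo 2. *)
Lemma trace2_mul s k (x : R) :
  x ^+ (2 ^ s) = x -> trace2 (k * s) x = (trace2 s x) *+ odd k.
Proof.
move=> xs; have xks j : x ^+ (2 ^ (j * s)) = x.
  by elim: j => [|j IH]; rewrite ?expr1 // mulSn expnD exprM xs IH.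
elim: k => [|k IH]; first by rewrite /trace2 big_ord0.
have -> : trace2 (k.+1 * s) x = trace2 (k * s) x + trace2 s x.
  rewrite /trace2 mulSn addnC -!(big_mkord xpredT (fun i => x ^+ (2 ^ i))).
  rewrite (@big_cat_nat _ _ _ (k * s)%N) ?leq_addr //=; congr (_ + _).
  rewrite -{1}[(k * s)%N]add0n big_addn addKn; apply: eq_bigr => i _.
  by rewrite addnC expnD exprM xks.
by rewrite IH /=; case: (odd k); rewrite ?add0r // addrr_pchar2.
Qed.

End Trace2.

Section EvenHalf.

Variables (F K : finFieldType) (iota : {rmorphism F -> K}) (m e : nat).
Hypotheses (m_gt0 : (0 < m)%N) (cardK : #|K| = (#|F| ^ m)%N) (Dq : #|F| = (2 ^ e)%N).
Local Notation q := #|F|.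

Lemma even_pchar2 : 2%N \in [pchar K].
Proof. by rewrite (fmorph_pchar iota) (card_finPcharP Dq). Qed.

Let K2 := even_pchar2.

Let P2 : 2%N \in [pchar {poly K}].
Proof. exact: (rmorph_pchar polyC). Qed.

Definition non_artin_schreier := [set x : K | [forall w : K, w ^+ 2 + w != x]].

Let horner_trace2 s (x : K) : (trace2 s 'X).[x] = trace2 s x.
Proof. by rewrite /trace2 horner_sum; apply: eq_bigr => i _; rewrite hornerXn. Qed.

(** The trace is 0 or 1, and it is 0 on every [w ^+ 2 + w]. Conversely, the trace polynomial
    composed with ['X^2 + 'X] is ['X^#|K| - 'X], so every element of trace 0 has this form. *)
Lemma non_artin_schreierP x : (x \in non_artin_schreier) = (trace2 (e * m) x == 1).
Proof.
have cardK2 : #|K| = (2 ^ (e * m))%N by rewrite cardK Dq expnM.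
rewrite inE; apply/forallP/eqP => [nas | x1 w]; last first.
  apply: contra_eq_neq x1 => <-; rewrite trace2_artin_schreier // -cardK2 expf_card.
  by rewrite addrr_pchar2 // eq_sym oner_neq0.
have /eqP := artin_schreier_trace2 K2 (e * m) x.
rewrite -cardK2 expf_card addrr_pchar2 // -[X in _ + X]mulr1 expr2 -mulrDr mulf_eq0.
rewrite addr_eq0 oppr_pchar2 // => /orP[/eqP x0 | /eqP //].
have [|||w] := @root_comp_dvd K (trace2 (e * m) 'X) ('X^2 + 'X) x.
- rewrite /trace2 rmorph_sum /=; under eq_bigr do rewrite comp_Xn_poly.
  by rewrite -/(trace2 _ _) trace2_artin_schreier // -cardK2 oppr_pchar2.
- by rewrite size_polyDl size_polyXn // size_polyX.
- by rewrite rootE horner_trace2 x0.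
by rewrite !hornerE => wx; move: (nas w); rewrite wx eqxx.
Qed.

Lemma size_trace2 s : size (trace2 s.+1 'X : {poly K}) = (2 ^ s).+1.
Proof.
elim: s => [|s IH]; first by rewrite /trace2 big_ord_recr /= big_ord0 add0r size_polyXn.
rewrite /trace2 big_ord_recr /= addrC size_polyDl size_polyXn //.
by rewrite [X in (X < _)%N]IH ltnS ltn_exp2l.
Qed.

Lemma card_non_artin_schreier_fixed d : (d %| m)%N ->
  2 * #|[set x in non_artin_schreier | x ^+ (q ^ d) == x]|%:R
    = if odd (m %/ d) then q%:R ^+ d - 0 else 0 :> rat.
Proof.
move=> d_m; set k := (m %/ d)%N; have Dm : m = (k * d)%N by rewrite divnK.
have d_gt0 : (0 < d)%N by apply: dvdn_gt0 d_m.
have e_gt0 : (0 < e)%N by have := finNzRing_gt1 F; rewrite Dq; case: (e).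
set N := (q ^ d)%N; have DN : N = (2 ^ (e * d))%N by rewrite /N Dq expnM.
have cardK' : #|K| = (N ^ k)%N by rewrite cardK Dm mulnC expnM.
have nasE x : x ^+ N = x ->
    (x \in non_artin_schreier) = odd k && (trace2 (e * d) x == 1).
  move=> xN; rewrite non_artin_schreierP Dm mulnCA trace2_mul //; last by rewrite -DN.
  by case: (odd k); rewrite ?mulr1n // mulr0n eq_sym oner_eq0.
have [odd_k | even_k] := boolP (odd k); last first.
  rewrite (_ : [set x in _ | _] = set0) ?cards0 ?mulr0 //.
  apply/setP => x; rewrite in_set in_set0; apply: negbTE; apply/andP => -[x_nsq /eqP xN].
  by move: x_nsq; rewrite nasE // (negPf even_k).
pose T : {poly K} := trace2 (e * d) 'X.
(* As a divisor of ['X^N - 'X], [T + 1] has as many roots as its degree, which is half of [N]. *)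
have DT : T * (T + 1) = 'X^N - 'X.
  by rewrite mulrDr mulr1 -expr2 artin_schreier_trace2 // -DN oppr_pchar2.
have -> : [set x in non_artin_schreier | x ^+ N == x] = [set x | root (T + 1) x].
  apply/setP => x; rewrite in_set [in RHS]in_set rootE !hornerE horner_trace2.
  rewrite addr_eq0 oppr_pchar2 //.
  apply/andP/eqP => [[x_nas /eqP xN] | xT].
    by move: x_nas; rewrite nasE // odd_k => /eqP.
  have xN : x ^+ N = x.
    apply/eqP; rewrite -root_frobenius_poly -DT rootM; apply/orP; right.
    by rewrite rootE !hornerE horner_trace2 xT addrr_pchar2.
  by rewrite nasE // odd_k xT xN !eqxx.
rewrite card_roots_dvd; last first.
  apply: (@dvdp_trans _ ('X^N - 'X)); last by rewrite cardK' frobenius_poly_dvd.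
  by rewrite -DT dvdp_mull.
have [s Ds] : exists s, (e * d)%N = s.+1.
  by exists (e * d).-1; rewrite prednK // muln_gt0 e_gt0.
rewrite /T Ds size_polyDl size_trace2 ?size_poly1 ?ltnS ?expn_gt0 //=.
by rewrite subr0 -natrX -/N DN Ds -natrM expnS.
Qed.

End EvenHalf.

(** * Reduction to counting field elements *)

Section Count.

Variables (F : finFieldType) (m : nat).
Hypothesis m_gt1 : (1 < m)%N.
Local Notation q := #|F|.

Let m_gt0 : (0 < m)%N := ltnW m_gt1.

Definition tsr_coef (b : F) : {ffun 'I_2 -> F} := [ffun i => if i == 0 then 1 else b].

Lemma tsr_coef0 b : tsr_coef b 0 = 1. Proof. by rewrite ffunE eqxx. Qed.
Lemma tsr_coef1 b : tsr_coef b 1 = b. Proof. by rewrite ffunE. Qed.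

Definition good_mx b : {set 'M[F]_m} :=
  [set A | irreducibleb (char_poly (tsr_mx (tsr_coef b) A))].

Lemma eq_tsr_mx2 (c c' : {ffun 'I_2 -> F}) (A A' : 'M[F]_m) :
  tsr_mx c A = tsr_mx c' A' <-> c 0 *: A = c' 0 *: A' /\ c 1 *: A = c' 1 *: A'.
Proof.
by rewrite !tsr_mx2E; split=> [/castmx_sq_inj/eq_block_mx[_ -> _ ->] | [-> ->]].
Qed.

(* The scaling [(c, A) ~ (l c, A / l)] allows the normalisation [c_0 = 1]. *)
Lemma card_TSRI : #|TSRI F m 2| = (\sum_b #|good_mx b|)%N.
Proof.
pose D : {set F * 'M[F]_m} := [set p | p.2 \in good_mx p.1].
pose h (p : F * 'M[F]_m) := tsr_mx (tsr_coef p.1) p.2.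
have h_inj : {in D &, injective h}.
  move=> [b A] [b' A']; rewrite !inE /= => /irreducibleP irr _ /eq_tsr_mx2.
  rewrite /= !tsr_coef0 !tsr_coef1 !scale1r => -[<- eq_bA].
  (* If [b] and [b'] differ, then [A = 0], and the same matrix arises from [c = 0], against
     irreducibility. *)
  congr (_, _); apply/eqP; rewrite -subr_eq0; apply: contraT => bb.
  have : (b - b') *: A == 0 by rewrite scalerBl eq_bA subrr.
  rewrite scaler_eq0 (negPf bb) /= => /eqP A0.
  have eqT : tsr_mx (tsr_coef b) A = tsr_mx 0 A by apply/eq_tsr_mx2; rewrite A0 !scaler0.
  by move: irr; rewrite eqT => /(irreducible_tsr_c0 m_gt1); rewrite ffunE eqxx.
have <- : h @: D = TSRI F m 2.
  apply/setP => T; apply/imsetP/idP => [[[b A]] | ].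
    rewrite inE /= inE => irr ->; rewrite inE irr andbT.
    by apply/imset2P; exists (tsr_coef b) A.
  rewrite inE => /andP[/imset2P[c A _ _ ->] irr].
  have c0 : c 0 != 0 by apply: (irreducible_tsr_c0 m_gt1) (elimT (irreducibleP _) irr).
  have eqT : tsr_mx c A = h (c 1 / c 0, c 0 *: A).
    by apply/eq_tsr_mx2; rewrite tsr_coef0 tsr_coef1 scale1r scalerA divfK.
  by exists (c 1 / c 0, c 0 *: A); rewrite // inE /= inE -[tsr_mx _ _]eqT.
rewrite card_in_imset // -sum1_card.
under [RHS]eq_bigr do rewrite -sum1_card.
rewrite pair_big_dep /=; apply: eq_bigl => p.
by rewrite inE.
Qed.

Lemma card_GL_prod n : (0 < n)%N ->
  #|'GL_n[F]%g|%:R = \prod_(0 <= i < n) (q%:R ^+ n - q%:R ^+ i) :> rat.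
Proof.
move=> n_gt0; rewrite card_GL // natrM natrX natr_prod.
have -> : q%:R ^+ 'C(n, 2) = \prod_(0 <= i < n) q%:R ^+ i :> rat.
  by rewrite -bin2_sum; elim/big_rec2: _ => [|i x y _ <-]; rewrite ?expr0 // exprD.
have -> : \prod_(1 <= i < n.+1) (q ^ i - 1)%:R
    = \prod_(0 <= i < n) (q%:R ^+ (n - i) - 1) :> rat.
  rewrite big_add1 /= big_nat_rev /= add0n big_nat [RHS]big_nat.
  apply: eq_bigr => i /andP[_ lt_in].
  rewrite subnSK // natrB ?natrX // expn_gt0 ltnW ?finNzRing_gt1 //.
rewrite -big_split /= big_nat [RHS]big_nat; apply: eq_bigr => i /andP[_ lt_in].
by rewrite mulrBr mulr1 -exprD subnKC // ltnW.
Qed.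

Variables (K : finFieldType) (iota : {rmorphism F -> K}).
Hypothesis cardK : #|K| = (q ^ m)%N.

Definition no_quad_root b : {set K} := [set a |
  (frob_order F a == m) && [forall z, z ^+ 2 != a * (iota b * z + 1)]].

(** Double counting of pairs of a good matrix [A] and a root [a] of [char_poly A]. Each [A] has [m]
    roots; each [a] belongs to the matrices whose characteristic polynomial is the minimal
    polynomial of [a]. *)
Lemma card_good_mx b :
  (#|good_mx b| * m * (q ^ m - 1) = #|no_quad_root b| * #|'GL_m[F]%g|)%N.
Proof.
pose rel (A : 'M[F]_m) (a : K) := root (map_poly iota (char_poly A)) a.
have size_cp (A : 'M[F]_m) : (size (char_poly A)).-1 = m by rewrite size_char_poly.
have goodP (A : 'M[F]_m) a : rel A a -> irreducible_poly (char_poly A) ->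
    (A \in good_mx b) = (a \in no_quad_root b).
  move=> Aa irr_A; have := irreducible_tsrP m_gt1 (c := tsr_coef b) cardK _ irr_A Aa.
  rewrite tsr_coef0 tsr_coef1 rmorph1 oner_neq0 => /(_ isT) irrP.
  rewrite !inE (frob_order_root irr_A Aa) size_cp eqxx /=.
  apply/irreducibleP/forallP => [/irrP no_z z | no_z]; first by apply/eqP/no_z.
  by apply/irrP => z; apply/eqP/no_z.
have good_irr (A : 'M[F]_m) : A \in good_mx b -> irreducible_poly (char_poly A).
  by rewrite inE => /irreducibleP /(irreducible_tsr_char_poly m_gt1).
have -> : (#|good_mx b| * m = \sum_(A in good_mx b) \sum_(a | rel A a) 1)%N.
  rewrite -sum_nat_const; apply: eq_bigr => A /good_irr irr_A.
  rewrite sum1_card; apply: esym.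
  apply: etrans (card_roots_irreducible iota cardK irr_A (size_cp A)).
  by apply: eq_card => a; rewrite inE.
rewrite (exchange_big_dep (mem (no_quad_root b))) /=; last first.
  by move=> A a goodA Aa; rewrite /= -(goodP A a Aa (good_irr _ goodA)).
rewrite big_distrl /= -sum_nat_const; apply: eq_bigr => a a_nq.
have [f [f_monic irr_f fa0]] := exists_min_poly iota m_gt0 cardK a.
have -> : frob_order F a = m by move: a_nq; rewrite inE => /andP[/eqP].
move=> sf; rewrite sum1_card.
rewrite (_ : #|_| = #|[set A : 'M[F]_m | char_poly A == f]|).
  move: (m) m_gt0 sf (m_gt1) => [|n] // _ sf _; apply: card_char_poly => //.
  by rewrite -sf prednK // ltnW // irr_f.1.
apply: eq_card => A; rewrite [RHS]inE unfold_in /=; apply/andP/eqP => [[goodA Aa]|Af].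
  apply/eqP; rewrite -eqp_monic // ?char_poly_monic // eqp_sym.
  apply: (good_irr A goodA).2; first by rewrite neq_ltn irr_f.1 orbT.
  exact: irreducible_root_dvd irr_f fa0 Aa.
have Aa : rel A a by rewrite /rel Af.
by rewrite (goodP A a) // Af.
Qed.

Lemma card_good_mx_rat b :
  #|good_mx b|%:R = #|no_quad_root b|%:R / m%:R
     * \prod_(1 <= i < m) (q%:R ^+ m - q%:R ^+ i) :> rat.
Proof.
have m_neq0 : m%:R != 0 :> rat by rewrite pnatr_eq0 -lt0n.
have qm_gt1 : (1 < q ^ m)%N by rewrite -(exp1n m) ltn_exp2r ?finNzRing_gt1.
have qm_neq0 : q%:R ^+ m - 1 != 0 :> rat.
  by rewrite subr_eq0 -natrX pnatr_eq1 gtn_eqF.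
have /(congr1 (fun n => n%:R : rat)) := card_good_mx b.
rewrite !natrM natrB ?(ltnW qm_gt1) // natrX card_GL_prod // big_ltn // expr0.
set P := \prod_(_ <= _ < _) _ => eqG.
apply: (mulIf m_neq0); apply: (mulIf qm_neq0); rewrite eqG.
by field.
Qed.

(** An injective map commuting with the Frobenius preserves degrees. The point [0] may be left out
    of the last hypothesis, having degree 1 while [m > 1]. *)
Lemma no_quad_root_preim (H : {set K}) (psi : K -> K) b :
    injective psi ->
    (forall a i, psi (iter i (@frob F K) a) = iter i (@frob F K) (psi a)) ->
    (forall a, a != 0 -> [forall z, z ^+ 2 != a * (iota b * z + 1)] = (psi a \in H)) ->
  #|no_quad_root b| = #|[set x in H | frob_order F x == m]|.
Proof.
move=> psi_inj psi_frob psiH.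
have frob_inj := frob_inj iota.
have ord_psi a : frob_order F (psi a) = frob_order F a.
  apply/eqP; rewrite eqn_dvd -!(iter_order_dvd _ _ frob_inj) -psi_frob.
  rewrite iter_order // eqxx /=; apply/eqP/psi_inj; rewrite psi_frob.
  exact: iter_order.
rewrite -(card_preimset [set x in H | frob_order F x == m] psi_inj).
apply: eq_card => a; rewrite !inE ord_psi andbC.
have [oa | //] := eqVneq; last by rewrite !andbF.
rewrite !andbT psiH //; apply: contraTneq isT => a0; move: m_gt1.
have : (frob_order F (0%R : K) %| 1)%N.
  by rewrite (frob_order_dvd iota) expr0n -leqn0 leqNgt expn_gt0 ltnW ?finNzRing_gt1.
by rewrite dvdn1 -oa a0 => /eqP->.
Qed.

End Count.

(** * Sums over odd divisors and the final count *)

Lemma sum_odd_divisors_pow2 (V : nmodType) l (g : nat -> V) :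
  \sum_(d <- divisors (2 ^ l) | odd d) g d = g 1%N.
Proof.
transitivity (\sum_(d <- [:: 1%N]) g d); last by rewrite big_seq1.
rewrite -big_filter; apply: perm_big; apply: uniq_perm => //.
  by rewrite filter_uniq ?divisors_uniq.
move=> d; rewrite mem_filter -dvdn_divisors ?expn_gt0 // inE.
apply/andP/eqP => [[odd_d] | ->]; last by rewrite dvd1n.
case/dvdn_pfactor => // -[|i] _ Dd; first by rewrite Dd.
by move: odd_d; rewrite Dd oddX.
Qed.

Lemma sum_odd_divisors_mobius l k : (3 <= k)%N -> odd k ->
  \sum_(d <- divisors (2 ^ l * k) | odd d) mobius d = 0.
Proof.
move=> k_ge3 odd_k; have k_gt1 : (1 < k)%N by apply: ltnW.
have p_pr := pdiv_prime k_gt1; apply: (@sum_mobius_prime odd (pdiv k)) => //.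
- by rewrite muln_gt0 expn_gt0 (ltnW k_gt1).
- by rewrite dvdn_mull ?pdiv_dvd.
by move=> d; rewrite oddM (dvdn_odd (pdiv_dvd k) odd_k).
Qed.

Section HalfCount.

Variables (F K : finFieldType) (iota : {rmorphism F -> K}) (m : nat).
Hypotheses (m_gt1 : (1 < m)%N) (cardK : #|K| = (#|F| ^ m)%N).
Local Notation q := #|F|.

(* Substituting [z = a (y + b) / 2] turns [z ^ 2 = a (b z + 1)] into
   [y ^ 2 = b ^ 2 + 4 / a]. *)
Lemma card_no_quad_root_odd b : odd q ->
  #|no_quad_root m iota b| = #|[set x in nonsquares K | frob_order F x == m]|.
Proof.
move=> odd_q; have two_neq0 : 2%:R != 0 :> K := odd_two_neq0 iota odd_q.
pose p : {poly F} := 4%:R *: 'X + (b ^+ 2)%:P.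
have evp x : (map_poly iota p).[x] = 4%:R * x + iota b ^+ 2.
  by rewrite /p rmorphD /= map_polyZ map_polyX map_polyC !hornerE /= rmorph_nat rmorphXn.
have four_neq0 : 4%:R != 0 :> K by rewrite (natrM _ 2 2) mulf_neq0.
(* The convention that [0] is its own inverse keeps this map injective on all of [K]. *)
apply: (@no_quad_root_preim _ _ m_gt1 _ iota _ (fun a => (map_poly iota p).[a^-1])).
- by move=> x y; rewrite !evp => /addIr /(mulfI four_neq0) /invr_inj.
- by move=> a i; rewrite -horner_iter_frob !iter_frob exprVn.
move=> a a_neq0; rewrite inE evp; apply/forallP/forallP => no z; apply/eqP => Dz.
  case/eqP: (no (a * (z + iota b) / 2%:R)); apply/eqP; rewrite -subr_eq0.
  set L := _ - _; have -> : L = a ^+ 2 / 4%:R * (z ^+ 2 - (4%:R * a^-1 + iota b ^+ 2)).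
    by rewrite /L; field; rewrite a_neq0 four_neq0 two_neq0.
  by rewrite Dz subrr mulr0.
case/eqP: (no (2%:R * z / a - iota b)); apply/eqP; rewrite -subr_eq0.
set L := _ - _; have -> : L = 4%:R / a ^+ 2 * (z ^+ 2 - a * (iota b * z + 1)).
  by rewrite /L; field; rewrite a_neq0.
by rewrite Dz subrr mulr0.
Qed.

(* Substituting [z = a b w] turns [z ^ 2 = a (b z + 1)] into
   [w ^ 2 + w = 1 / (a b ^ 2)]. *)
Lemma card_no_quad_root_even e b : q = (2 ^ e)%N -> b != 0 ->
  #|no_quad_root m iota b| = #|[set x in non_artin_schreier K | frob_order F x == m]|.
Proof.
move=> Dq b_neq0; have K2 : 2%N \in [pchar K] := even_pchar2 iota Dq.
have ib_neq0 : iota b != 0 by rewrite fmorph_eq0.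
pose p : {poly F} := b ^- 2 *: 'X.
have evp x : (map_poly iota p).[x] = iota b ^- 2 * x.
  by rewrite /p map_polyZ map_polyX !hornerE /= fmorphV rmorphXn.
have ib2_neq0 : iota b ^- 2 != 0 by rewrite invr_eq0 expf_neq0.
apply: (@no_quad_root_preim _ _ m_gt1 _ iota _ (fun a => (map_poly iota p).[a^-1])).
- by move=> x y; rewrite !evp => /(mulfI ib2_neq0) /invr_inj.
- by move=> a i; rewrite -horner_iter_frob !iter_frob exprVn.
have two0 : 2%:R = 0 :> K by exact: pcharf0.
move=> a a_neq0; rewrite inE evp; apply/forallP/forallP => no z; apply/eqP => Dz.
  case/eqP: (no (a * iota b * z)); apply/eqP; rewrite -subr_eq0.
  set L := _ - _; have -> : L = a ^+ 2 * iota b ^+ 2 * (z ^+ 2 + z - iota b ^- 2 * a^-1)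
      - 2%:R * (a ^+ 2 * iota b ^+ 2 * z).
    by rewrite /L; field; rewrite a_neq0 ib_neq0.
  by rewrite Dz subrr two0 mulr0 mul0r subrr.
case/eqP: (no (z / (a * iota b))); apply/eqP; rewrite -subr_eq0.
set L := _ - _.
have -> : L = (z ^+ 2 - a * (iota b * z + 1)) / (a * iota b) ^+ 2
    + 2%:R * (z / (a * iota b)).
  by rewrite /L; field; rewrite a_neq0 ib_neq0.
by rewrite Dz subrr two0 !mul0r addr0.
Qed.

Lemma no_quad_root_even0 e : q = (2 ^ e)%N -> no_quad_root m iota 0 = set0.
Proof.
move=> Dq; apply/setP => a; rewrite in_set in_set0; apply/negbTE.
rewrite negb_and negb_forall; apply/orP; right; apply/existsP.
have e_gt0 : (0 < e * m)%N.
  by rewrite muln_gt0 (ltnW m_gt1) andbT; have := finNzRing_gt1 F; rewrite Dq; case: (e).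
(* For [b = 0] the equation is [z ^+ 2 = a], and the witness is the square root of [a] given by the
   inverse of squaring. *)
exists (a ^+ (2 ^ (e * m).-1)); rewrite negbK rmorph0 mul0r add0r mulr1.
by rewrite -exprM mulnC -expnS prednK // expnM -Dq -cardK expf_card.
Qed.

End HalfCount.

Theorem theorem3p5 (F : finFieldType) (q m : nat) (hq : #|F| = q)
    (hm : (1 < m)%N) :
  let case1 := odd q /\ (exists l : nat, m = (2 ^ l)%N) in
  let case2 := odd q /\
    (exists l k : nat, [/\ m = (2 ^ l * k)%N, (3 <= k)%N & odd k]) in
  let S : rat := \sum_(d <- divisors m | odd d)
                   (mobius d)%:~R * q%:R ^+ (m %/ d) in
  [/\ case1 ->
        #|TSRI F m 2|%:R = q%:R / (2 * m)%:R
          * \prod_(0 <= i < m) (q%:R ^+ m - q%:R ^+ i) :> rat,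
      case2 ->
        #|TSRI F m 2|%:R = q%:R / (2 * m)%:R
          * \prod_(1 <= i < m) (q%:R ^+ m - q%:R ^+ i) * S :> rat
    & ~ (case1 \/ case2) ->
        #|TSRI F m 2|%:R = (q%:R - 1) / (2 * m)%:R
          * \prod_(1 <= i < m) (q%:R ^+ m - q%:R ^+ i) * S :> rat].
Proof.
move=> case1 case2 S; have m_gt0 := ltnW hm.
have [K [iota cardK]] := finField_extension F m_gt0.
have m_neq0 : m%:R != 0 :> rat by rewrite pnatr_eq0 -lt0n.
set P := \prod_(1 <= i < m) _.
have cardT : #|TSRI F m 2|%:R = \sum_b #|no_quad_root m iota b|%:R / m%:R * P :> rat.
  rewrite card_TSRI // natr_sum; apply: eq_bigr => b _.
  by rewrite (card_good_mx_rat hm iota cardK) hq.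
pose Seps (eps : rat) := \sum_(d <- divisors m | odd d)
   (mobius d)%:~R * (q%:R ^+ (m %/ d) - eps) : rat.
have SepsE eps : Seps eps = S - eps * (\sum_(d <- divisors m | odd d) mobius d)%:~R.
  rewrite rmorph_sum /= mulr_sumr -sumrB; apply: eq_bigr => d _.
  by rewrite mulrBr [eps * _]mulrC.
have cardT_odd : odd q -> #|TSRI F m 2|%:R = q%:R / (2 * m)%:R * P * Seps 1.
  rewrite -hq => odd_q; rewrite cardT (eq_bigr (fun=> Seps 1 / (2 * m)%:R * P)).
    by rewrite sumr_const -[LHS]mulr_natl hq; ring.
  move=> b _; rewrite card_no_quad_root_odd // /Seps -hq.
  have := card_full_order iota m_gt0 cardK (card_nonsquares_fixed iota m_gt0 cardK odd_q).
  by move=> <-; rewrite natrM; field.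
have cardT_even : ~~ odd q -> #|TSRI F m 2|%:R = (q%:R - 1) / (2 * m)%:R * P * Seps 0.
  rewrite -hq => even_q; have [p p_pr pF] := finPcharP F.
  have [e Dqp] : exists e, #|F| = (p ^ e)%N.
    by exists (logn p #|F|); apply: card_pprimeChar pF.
  have p2 : p = 2%N.
    by have [// | odd_p] := even_prime p_pr; move: even_q; rewrite Dqp oddX odd_p orbT.
  have Dq : #|F| = (2 ^ e)%N by rewrite Dqp p2.
  (* The term [b = 0] vanishes, which turns the factor [q] of the odd case into [q - 1]. *)
  rewrite cardT (bigD1 0) //= (no_quad_root_even0 iota hm cardK Dq) cards0 !mul0r add0r.
  rewrite (eq_bigr (fun=> Seps 0 / (2 * m)%:R * P)).
    have Dq1 : #|F|.-1%:R = q%:R - 1 :> rat.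
      by rewrite -hq -subn1 natrB // ltnW // finNzRing_gt1.
    by rewrite sumr_const cardC1 -[LHS]mulr_natl Dq1 hq; ring.
  move=> b b_neq0; rewrite (card_no_quad_root_even iota hm Dq) // /Seps -hq.
  have cardH := card_non_artin_schreier_fixed iota m_gt0 cardK Dq.
  have := card_full_order iota m_gt0 cardK cardH.
  by move=> <-; rewrite natrM; field.
split.
(* Only [d = 1] contributes, and its term [q ^ m - 1] is the factor [i = 0] of the product. *)
- case=> odd_q [l Dm]; rewrite cardT_odd // big_ltn // -/P expr0 /Seps.
  have -> g : \sum_(d <- divisors m | odd d) g d = g 1%N :> rat.
    by rewrite Dm sum_odd_divisors_pow2.
  by rewrite divn1 mul1r; ring.
(* The correction by [eps = 1] is the Moebius sum over odd divisors, which vanishes thanks to an odd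
   prime factor of [k]. *)
- case=> odd_q [l [k [Dm k_ge3 odd_k]]]; rewrite cardT_odd // SepsE Dm.
  by rewrite sum_odd_divisors_mobius // mulr0 subr0 -Dm.
(* For odd [q], splitting off the power of 2 in [m] leads to one of the first two cases, so here [q]
   is even. *)
move=> not12; rewrite cardT_even; first by rewrite SepsE mul0r subr0.
apply/negP => odd_q; apply: not12.
have [k] := pfactor_coprime (isT : prime 2) m_gt0; rewrite coprime2n => odd_k Dm.
have [k1 | k_neq1] := eqVneq k 1%N.
  by left; split=> //; exists (logn 2 m); rewrite {1}Dm k1 mul1n.
right; split=> //; exists (logn 2 m), k; split=> //; first by rewrite mulnC.
by case: k odd_k k_neq1 {Dm} => [|[|[|k]]].
Qed.
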